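(* Let $E$ be a real or complex locally convex topological vector space and let $f,g\in\Gamma_0(E)$. Then: (i) On the set $\mathcal W=\{(f,g)\in\Gamma_0(E)\times\Gamma_0(E):\ \mathrm{dom}\,f^*=E^*\text{ and }\mathrm{dom}\,g^*=E^*\}$, the binary map $(f,g)\longmapsto L(f,g)$ is separately point-wise increasing and separately point-wise concave (i.e. with respect to each of its two arguments, the other being fixed). (ii) The functional arithmetic-logarithmic-harmonic inequality holds: $$f!g\leq L(f,g)\leq f\nabla g .$$ Thus, $L(f,g)\in\Gamma_0(E)$ provided that $\mathrm{dom}\,f\cap\mathrm{dom}\,g\neq\emptyset$.
   Context: $E^*$ is the topological dual of $E$, with duality bracket $\langle x^*,x\rangle$. Conventions in $[-\infty,+\infty]$: $a+(+\infty)=+\infty$ for every $a$, $(+\infty)-(+\infty)=+\infty$, $0\cdot(+\infty)=+\infty$; $a\le b$ means $b-a\ge 0$, with $-\infty\le a\le+\infty$ for all $a$. Functionals are ordered point-wise. $\mathrm{dom}\,f=\{x: f(x)<+\infty\}$. $\Gamma_0(E)$ is the set of all convex lower semi-continuous proper functionals $f:E\to\mathbb R\cup\{+\infty\}$ (proper: never $-\infty$ and not identically $+\infty$). Conjugates: for $f:E\to[-\infty,+\infty]$, $f^*(x^* )=\sup_{x\in E}\{\Re e\langle x^*,x\rangle-f(x)\}$ on $E^*$; for $\varphi:E^*\to[-\infty,+\infty]$, $\varphi^*(x)=\sup_{x^*\in E^*}\{\Re e\langle x^*,x\rangle-\varphi(x^* )\}$ on $E$ (only the duality between $E$ and $E^*$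 is used). For $\lambda\in(0,1)$: $f\nabla_\lambda g=(1-\lambda)f+\lambda g$, $f!_\lambda g=\big((1-\lambda)f^*+\lambda g^*\big)^*$, $f\sharp_\lambda g=\frac{\sin(\pi\lambda)}{\pi}\int_0^1\frac{t^{\lambda-1}}{(1-t)^\lambda}\,f!_tg\,dt$ (integral taken point-wise). By convention $f\nabla_0g=f!_0g=f\sharp_0g=f$ and $f\nabla_1g=f!_1g=f\sharp_1g=g$. Write $f\nabla g=f\nabla_{1/2}g$ and $f!g=f!_{1/2}g$. The same expressions are used for arbitrary functionals not necessarily in $\Gamma_0(E)$. The logarithmic mean is $L(f,g)=\int_0^1 f\sharp_tg\,dt$ (point-wise). A map $F$ with functional values is point-wise increasing if $f_1\le f_2$ implies $F(f_1)\le F(f_2)$, and point-wise concave if $F((1-t)f_1+tf_2)\ge(1-t)F(f_1)+tF(f_2)$ for $t\in(0,1)$, for the point-wise order.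
   Formalization: The last claim needs also dom f* ∩ dom g* ≠ ∅ for L(f,g) to be proper (f(x)=x, g(x)=−x on R gives L=−∞); without it only convexity, lower semicontinuity and L not identically +∞ are stated. *)

(* Defs.v *)
From HB Require Import structures.
From mathcomp Require Import all_boot all_order all_algebra.
From mathcomp Require Import all_classical all_reals all_analysis.
From mathcomp Require Import complex.

Set Implicit Arguments.
Unset Strict Implicit.
Unset Printing Implicit Defensive.

Import Order.TTheory GRing.Theory Num.Theory.
Import numFieldNormedType.Exports.

Local Open Scope classical_set_scope.
Local Open Scope ring_scope.

(* The scalars of a "real or complex" space: R or R[i], according to k. *)
Variant scalar_kind := RealScalars | ComplexScalars.

Definition scalar_field (R : realType) (k : scalar_kind) : numFieldType :=
  match k with RealScalars => R | ComplexScalars => R[i] end.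

Definition of_real (R : realType) (k : scalar_kind) : R -> scalar_field R k :=
  match k with
  | RealScalars => fun a => a
  | ComplexScalars => fun a => real_complex R a
  end.
Arguments of_real {R} k _.

Definition re_part (R : realType) (k : scalar_kind) : scalar_field R k -> R :=
  match k with
  | RealScalars => fun z => z
  | ComplexScalars => fun z => complex.Re z
  end.
Arguments re_part {R} k _.

Definition pointwise_le (R : realType) (T : Type) (f g : T -> \bar R) : Prop :=
  forall x, (f x <= g x)%E.

Definition edom (R : realType) (T : Type) (f : T -> \bar R) : set T :=
  [set x | (f x < +oo)%E].

(* The library's addition has (-oo) + (+oo) = -oo; its dual addition (scope dE)
   has a + (+oo) = +oo for every a, which is the convention wanted here.  The
   convention 0 * (+oo) = +oo never intervenes: coefficients are positive once
   l = 0 and l = 1 are set apart. *)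
Definition arith_mean (R : realType) (T : Type) (l : R) (f g : T -> \bar R) :
    T -> \bar R :=
  if l == 0 then f else if l == 1 then g
  else fun x => ((1 - l)%:E * f x + l%:E * g x)%dE.

Definition pointwise_increasing (R : realType) (S T : Type)
    (D : set (S -> \bar R)) (F : (S -> \bar R) -> (T -> \bar R)) : Prop :=
  forall f1 f2, D f1 -> D f2 ->
    pointwise_le f1 f2 -> pointwise_le (F f1) (F f2).

(* The combination [arith_mean t f1 f2] is not required to belong to D: for f1
   and f2 in Gamma0 with disjoint domains it is identically +oo. *)
Definition pointwise_concave (R : realType) (S T : Type)
    (D : set (S -> \bar R)) (F : (S -> \bar R) -> (T -> \bar R)) : Prop :=
  forall f1 f2 (t : R), D f1 -> D f2 -> 0 < t < 1 ->
    pointwise_le (arith_mean t (F f1) (F f2)) (F (arith_mean t f1 f2)).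

Section functionals.
Context (R : realType) (k : scalar_kind) (E : tvsType (scalar_field R k)).

Record dual := Dual {
  dual_fun :> {linear E -> (scalar_field R k)^o};
  dual_continuous : continuous dual_fun }.

Implicit Types (f g : E -> \bar R) (l t : R).

Definition convex_functional f : Prop :=
  forall (x y : E) t, 0 < t < 1 ->
    (f (of_real k (1 - t) *: x + of_real k t *: y)%R
     <= ((1 - t)%:E * f x + t%:E * f y)%dE)%E.

Definition proper_functional f : Prop :=
  (forall x, f x != -oo%E) /\ (exists x, f x != +oo%E).

Definition Gamma0 : set (E -> \bar R) :=
  [set f | [/\ convex_functional f, lower_semicontinuous f
             & proper_functional f]].

Definition conjugate f : dual -> \bar R :=
  fun p => ereal_sup (range (fun x : E => ((re_part k (p x))%:E - f x)%E)).

Definition conjugate_dual (phi : dual -> \bar R) : E -> \bar R :=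
  fun x => ereal_sup (range (fun p : dual => ((re_part k (p x))%:E - phi p)%E)).

Definition harm_mean l f g : E -> \bar R :=
  if l == 0 then f else if l == 1 then g
  else conjugate_dual (arith_mean l (conjugate f) (conjugate g)).

(* The weight is singular at both ends, hence the open interval. *)
Definition geom_mean l f g : E -> \bar R :=
  if l == 0 then f else if l == 1 then g
  else fun x => ((sin (pi * l) / pi)%:E *
    \int[@lebesgue_measure R]_(t in `]0%R, 1%R[)
      ((t `^ (l - 1) / (1 - t) `^ l)%:E * harm_mean t f g x))%E.

Definition log_mean f g : E -> \bar R :=
  fun x => (\int[@lebesgue_measure R]_(t in `[0%R, 1%R]) geom_mean t f g x)%E.

Definition finite_conjugates : set ((E -> \bar R) * (E -> \bar R)) :=
  [set fg | [/\ Gamma0 fg.1, Gamma0 fg.2,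
    edom (conjugate fg.1) = setT & edom (conjugate fg.2) = setT]].

End functionals.

(* Main.v *)
(* For fixed [x], [h t := harm_mean t f g x] is a supremum of functions affine in
   [t], one for each dual point at which both conjugates are finite.  By Tonelli,
   [log_mean f g x] is the integral of [h] against the probability density
   [log_weight t = 1 / (t (1 - t) (pi^2 + ln^2 (t / (1 - t))))] on the unit
   interval, whose mean is 1/2 by the symmetry [t <-> 1 - t]; the inequalities in
   (ii) amount to integrating affine bounds on [h].  Joint concavity of
   [(f, g) |-> h t] follows by combining dual points:
   [conjugate ((1 - s) f1 + s f2) ((1 - s) p1 + s p2)
      <= (1 - s) conjugate f1 p1 + s conjugate f2 p2]. *)
Require Import Defs.
From HB Require Import structures.
From mathcomp Require Import all_boot all_order all_algebra.
From mathcomp Require Import all_classical all_reals all_analysis.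
From mathcomp Require Import complex ring lra measurable_realfun.

Set Implicit Arguments.
Unset Strict Implicit.
Unset Printing Implicit Defensive.

Import Order.TTheory GRing.Theory Num.Theory.
Import numFieldNormedType.Exports DualAddTheory.

Local Open Scope classical_set_scope.
Local Open Scope ring_scope.

(** In the variable [u = ln t - ln (1 - t)] the density [log_weight] is the Cauchy law of scale
    [pi]; hence its total mass one and its primitive by [atan]. The obstacle is that [h] is a
    supremum over an uncountable set and may be infinite, so that neither its measurability nor an
    exchange of integrals is automatic. Each dual point contributes [(1 - t) * A + t * B] with a
    pair of reals [A], [B] independent of [t]. Choosing one dual point above each rational pair that
    can be dominated gives a countable family with the same supremum for all [t] at once; this
    yields measurability and allows monotone convergence. A single dual point with both conjugates
    finite bounds [h] below, so adding a constant reduces signed integrals to nonnegative ones. If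
    there is no such point, [log_mean f g] is identically [-oo] and is treated apart. *)

Section logarithmic_weight.
Context {R : realType}.
Implicit Types (l t a b : R).
Local Notation mu := (@lebesgue_measure R).

(** * The density [log_weight]: origin, regularity, primitive *)

Lemma FTC2_is_derive (f F : R -> R) a b : a < b ->
  {in `[a, b], forall x, is_derive x (1:R) F (f x)} ->
  {in `[a, b], forall x, {for x, continuous f}} ->
  (\int[mu]_(x in `[a, b]) (f x)%:E = (F b)%:E - (F a)%:E)%E.
Proof.
move=> ab dF cf.
have cF : {in `[a, b], forall x, {for x, continuous F}}.
  move=> x xab; apply: differentiable_continuous; apply/derivable1_diffP.
  by have [] := dF _ xab.
apply: continuous_FTC2 => //.
- by apply: continuous_in_subspaceT => x /set_mem; exact: cf.
- split.
  + by move=> x /subset_itv_oo_cc xab; have [] := dF _ xab.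
  + by apply: cvg_at_right_filter; apply: cF; rewrite in_itv/= lexx ltW.
  + by apply: cvg_at_left_filter; apply: cF; rewrite in_itv/= lexx ltW.
- move=> x /subset_itv_oo_cc xab; rewrite derive1E.
  by apply: derive_val; exact: dF.
Qed.

(** The normalised weight of [geom_mean], in exponential form: the dependence on [l] becomes a
    single exponential, and joint measurability in [l] and [t] follows by composition. *)
Definition geom_weight l t : R :=
  sin (pi * l) / pi * expR ((l - 1) * ln t - l * ln (1 - t)).

Definition log_weight t : R :=
  (t * (1 - t) * (pi ^+ 2 + (ln t - ln (1 - t)) ^+ 2))^-1.

Lemma geom_weightE l t : 0 < t < 1 ->
  sin (pi * l) / pi * (t `^ (l - 1) / (1 - t) `^ l) = geom_weight l t.
Proof.
move=> /andP[t0 t1]; rewrite /geom_weight /powR gt_eqF// gt_eqF ?subr_gt0//.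
by rewrite expRD expRN.
Qed.

Lemma integral_geom_weight t : 0 < t < 1 ->
  (\int[mu]_(l in `]0%R, 1%R[) (geom_weight l t)%:E = (log_weight t)%:E)%E.
Proof.
move=> /andP[t0 t1].
set u := ln t - ln (1 - t).
have t'0 : 0 < 1 - t by rewrite subr_gt0.
have pi0 : 0 < pi :> R := pi_gt0 R.
have D0 : pi ^+ 2 + u ^+ 2 != 0 :> R.
  by rewrite gt_eqF// ltr_pwDl ?sqr_ge0// exprn_gt0.
have eu : expR u = t / (1 - t) by rewrite expRD expRN !lnK ?posrE.
have kE l : geom_weight l t = sin (pi * l) / pi * expR (u * l) / t.
  rewrite /geom_weight -!mulrA; congr (_ * (_ * _)).
  rewrite (_ : _ - _ = u * l - ln t); last by rewrite /u; ring.
  by rewrite expRD expRN lnK ?posrE.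
(* The primitive of [sin (pi * l) * expR (u * l)] obtained by integrating by parts twice. Since
   [cos pi = - 1], the end values give [(expR u + 1) / (t * (pi ^+ 2 + u ^+ 2))], and
   [expR u + 1 = (1 - t)^-1]. *)
pose F l := expR (u * l) * (u * sin (pi * l) - pi * cos (pi * l)) /
  (pi * t * (pi ^+ 2 + u ^+ 2)).
have dF l : is_derive l (1:R) F (geom_weight l t).
  rewrite kE /F; apply: is_derive_eq; rewrite /GRing.scale/=.
  move: (sin _) (cos _) (expR _) pi0 D0 => s c e; move: (pi : R) => p p0 D0.
  by field; rewrite D0 !gt_eqF.
have ck l : {for l, continuous (fun l => geom_weight l t)}.
  rewrite (_ : (fun l => geom_weight l t) =
    fun l => sin (pi * l) / pi * expR (u * l) / t).
    apply: differentiable_continuous; apply/derivable1_diffP.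
    exact: ex_derive.
  exact/funext.
rewrite -(@integral_itv_bndoo _ 0 1 _ true false).
  rewrite (@FTC2_is_derive _ F)//.
  rewrite /F !mulr1 !mulr0 sinpi cospi sin0 cos0 expR0 eu -EFinB; congr (_%:E).
  rewrite /log_weight -/u; move: pi0 D0; move: (pi : R) => p p0 D0.
  by field; rewrite D0 !gt_eqF.
apply/measurable_EFinP; apply: measurable_funTS.
by apply: continuous_measurable_fun => l; exact: ck.
Qed.

Lemma log_weight_gt0 t : 0 < t < 1 -> 0 < log_weight t.
Proof.
move=> /andP[t0 t1]; rewrite invr_gt0 !mulr_gt0// ?subr_gt0//.
by rewrite ltr_pwDl ?sqr_ge0// exprn_gt0// pi_gt0.
Qed.

Lemma log_weight_onem t : log_weight (1 - t) = log_weight t.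
Proof.
rewrite /log_weight opprB addrCA subrr addr0; congr (_^-1).
ring.
Qed.

Lemma is_derive_ln_onem t : t < 1 ->
  is_derive t (1:R) (fun t => ln (1 - t)) (- (1 - t)^-1).
Proof.
move=> t1; have t'0 : 0 < 1 - t by rewrite subr_gt0.
have -> : - (1 - t)^-1 = (1 - t)^-1 * (0 - 1) by rewrite sub0r mulrN1.
exact: (@is_derive1_comp _ (@ln R) (fun t => 1 - t) t _ _ (is_derive1_ln t'0)).
Qed.

Lemma is_derive_logit t : 0 < t < 1 ->
  is_derive t (1:R) (fun t => ln t - ln (1 - t)) (t * (1 - t))^-1.
Proof.
move=> /andP[t0 t1]; have t'0 : 0 < 1 - t by rewrite subr_gt0.
have -> : (t * (1 - t))^-1 = t^-1 - (- (1 - t)^-1).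
  by field; rewrite !gt_eqF.
exact: (is_deriveB (is_derive1_ln t0) (is_derive_ln_onem t1)).
Qed.

Lemma continuous_log_weight t : 0 < t < 1 -> {for t, continuous log_weight}.
Proof.
move=> t01.
apply: differentiable_continuous; apply/derivable1_diffP.
have := is_derive_logit t01.
rewrite /log_weight => dl.
apply: derivableV; last exact: ex_derive.
by rewrite gt_eqF// -invr_gt0; exact: log_weight_gt0.
Qed.

Lemma measurable_log_weight :
  measurable_fun (`]0%R, 1%R[%classic : set R) log_weight.
Proof.
apply: open_continuous_measurable_fun; first exact: interval_open.
by move=> t /set_mem/=; rewrite in_itv/= => /continuous_log_weight.
Qed.

Lemma is_derive_atan_logit t : 0 < t < 1 ->
  is_derive t (1:R) (fun t => pi^-1 * atan (pi^-1 * (ln t - ln (1 - t))))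
    (log_weight t).
Proof.
move=> t01; have := is_derive_logit t01 => dl.
have dl1 : is_derive t (1:R) (fun t => pi^-1 * (ln t - ln (1 - t)))
  (pi^-1 * (t * (1 - t))^-1).
  exact: (is_deriveZ pi^-1).
have dl2 := @is_derive1_comp _ _ _ _ _ _ (is_derive1_atan _) dl1.
have -> : log_weight t =
    pi^-1 * ((1 + (pi^-1 * (ln t - ln (1 - t))) ^+ 2)^-1 *
      (pi^-1 * (t * (1 - t))^-1)).
  rewrite /log_weight; have /andP[t0 t1] := t01.
  move: (ln _ - ln _) (pi_gt0 R) => u.
  move: (pi : R) => p p0; field.
  by rewrite !gt_eqF ?subr_gt0// ltr_wpDr ?sqr_ge0 ?exprn_gt0.
exact: (is_deriveZ pi^-1).
Qed.
End logarithmic_weight.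

(** * Mass and first moment of [log_weight] *)

Section mass.
Context {R : realType}.
Local Notation mu := (@lebesgue_measure R).

Let onemR : measurableTypeR R -> measurableTypeR R := fun x => 1 - x.

Let measurable_onemR : measurable_fun [set: measurableTypeR R] onemR.
Proof. exact: measurable_funB. Qed.

(** Lebesgue measure is determined by its values on the intervals []a, b]]; their preimages [[1 - b,
    1 - a[] have the same length. *)
Lemma lebesgue_measure_onem (A : set R) : measurable A ->
  pushforward mu onemR A = mu A.
Proof.
move=> mA; apply/esym/(lebesgue_measure_unique (mu :=
  measure_function.pushforward mu onemR)) => //= _ [[a b]] _ <-.
rewrite /pushforward (_ : _ @^-1` _ = `[1 - b, 1 - a[%classic); last first.
  by apply/seteqP; split=> x /=; rewrite /onemR !in_itv/= => /andP[? ?];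
    apply/andP; split; lra.
rewrite !lebesgue_measure_itv/= !lte_fin ltrD2l ltrN2.
by case: ifPn => // _; rewrite -!EFinB; congr (_%:E); lra.
Qed.

Lemma ge0_integral_onem (f : R -> \bar R) :
  measurable_fun (`]0%R, 1%R[%classic : set R) f ->
  (forall t, t \in `]0%R, 1%R[ -> 0 <= f t)%E ->
  (\int[mu]_(t in `]0%R, 1%R[) f (1 - t)%R = \int[mu]_(t in `]0%R, 1%R[) f t)%E.
Proof.
move=> mf f0.
rewrite -[RHS](@eq_measure_integral _ _ _ _ _ (pushforward mu onemR)); last first.
  by move=> A mA _; exact: lebesgue_measure_onem.
rewrite (ge0_integral_pushforward measurable_onemR)//;
  last by move=> t /set_mem/f0.
congr integral; apply/seteqP; split=> x /=;
  rewrite /onemR !in_itv/= => /andP[? ?]; apply/andP; split; lra.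
Qed.

Lemma integral_log_weight :
  (\int[mu]_(t in `]0%R, 1%R[) (log_weight t)%:E = 1)%E.
Proof.
(* The shift by 3 gives [a n <= 3^-1], so the compact intervals where the fundamental theorem
   applies are nondegenerate from [n = 0] on; moreover [(1 - a n) / a n] is the integer [n.+2]. *)
pose a n : R := n.+3%:R^-1.
have a0 n : 0 < a n by rewrite invr_gt0.
have a1 n : a n < 1 - a n.
  have : a n <= 3^-1 by rewrite lef_pV2 ?posrE// ler_nat.
  lra.
pose F n : set R := `[a n, 1 - a n]%classic.
have F01 n : F n `<=` `]0, 1[%classic.
  move=> t; rewrite /F /= !in_itv/= => /andP[at_ ta].
  by rewrite (lt_le_trans (a0 n))//= (le_lt_trans ta)// ltrBlDr ltrDl.
have UF : \bigcup_n F n = `]0, 1[%classic.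
  apply/seteqP; split=> [t [n _ /F01]//|t /=]; rewrite in_itv/= => /andP[t0 t1].
  have m0 : 0 < Num.min t (1 - t) by rewrite lt_min t0 subr_gt0.
  have [n n0] : exists n, (Num.min t (1 - t))^-1 <= n%:R.
    exists (Num.bound (Num.min t (1 - t))^-1).
    by apply/ltW; rewrite archi_boundP// invr_ge0 ltW.
  exists n => //; rewrite /F/= in_itv/=.
  have : a n <= Num.min t (1 - t).
    rewrite -[leRHS]invrK lef_pV2 ?posrE ?invr_gt0//.
    by rewrite (le_trans n0)// ler_nat; do 3!apply: leqW.
  by rewrite le_min => /andP[-> ?]/=; lra.
have ndF : nondecreasing_seq F.
  move=> m n mn; apply/subsetPset => t; rewrite /F /= !in_itv/=.
  have : a n <= a m by rewrite lef_pV2 ?posrE// ler_nat.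
  by move=> anm /andP[? ?]; apply/andP; split; lra.
have H : (\int[mu]_(x in F i) (log_weight x)%:E @[i --> \oo] -->
    \int[mu]_(x in `]0%R, 1%R[) (log_weight x)%:E)%E.
  rewrite -UF; apply: ge0_nondecreasing_set_cvg_integral => //.
  - by move=> n; exact: measurable_itv.
  - move=> n; apply/measurable_EFinP.
    by apply: measurable_funS measurable_log_weight => //; exact: F01.
  - by move=> n t /F01; rewrite /= in_itv/= lee_fin => /log_weight_gt0/ltW.
apply: cvg_unique H _ => //.
have -> : (fun i => \int[mu]_(x in F i) (log_weight x)%:E)%E =
    (fun n => (2 * (pi^-1 * atan (pi^-1 * ln n.+2%:R)))%:E).
  apply/funext => n; rewrite (FTC2_is_derive (a1 n)
    (F := fun t => pi^-1 * atan (pi^-1 * (ln t - ln (1 - t))))); last 2 first.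
  - by move=> t /F01; rewrite /= in_itv/=; exact: is_derive_atan_logit.
  - by move=> t /F01; rewrite /= in_itv/=; exact: continuous_log_weight.
  have lE : ln (1 - a n) - ln (a n) = ln n.+2%:R.
    rewrite -ln_div ?posrE ?subr_gt0//; last by have := a0 n; have := a1 n; lra.
    congr ln; rewrite /a invrK mulrBl mul1r mulVf//.
    by rewrite -[in LHS]natr1 addrK.
  rewrite opprB addrCA subrr addr0 -(opprB (ln (1 - _))) lE.
  by rewrite mulrN atanN mulrN -EFinB opprK mulr_natl mulr2n.
apply: cvg_EFin; first exact: nearW.
rewrite (_ : fine \o _ = fun n => 2 * (pi^-1 * atan (pi^-1 * ln n.+2%:R)))//.
rewrite [X in _ --> X](_ : _ = 2 * (pi^-1 * (pi / 2))); last first.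
  by have := pi_gt0 R; move: (pi : R) => p p0; field; rewrite gt_eqF.
apply: cvgM; first exact: cvg_cst.
apply: cvgM; first exact: cvg_cst.
apply: (@cvg_comp _ _ _ (fun n => pi^-1 * ln n.+2%:R) (@atan R) _ _ _ _
  (@cvgy_atan R)).
apply/cvgryPge => A.
exists (Num.truncn (expR (pi * A))).+1 => // n /= An.
rewrite ler_pdivlMl ?pi_gt0// -(expRK (pi * A)) ler_ln ?posrE ?expR_gt0//.
apply/ltW; apply: (lt_le_trans (truncnS_gt _)).
by rewrite ler_nat (leq_trans An)// leqW// leqW.
Qed.

Lemma integral_log_weight_onem :
  (\int[mu]_(t in `]0%R, 1%R[) ((1 - t) * log_weight t)%:E =
  \int[mu]_(t in `]0%R, 1%R[) (t * log_weight t)%:E)%E.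
Proof.
under eq_integral do rewrite -log_weight_onem.
rewrite (@ge0_integral_onem (fun t => (t * log_weight t)%:E))//.
  by apply/measurable_EFinP; apply: measurable_funM => //;
    exact: measurable_log_weight.
by move=> t; rewrite in_itv/= => t01;
  rewrite lee_fin mulr_ge0 ?(ltW (log_weight_gt0 _))//; case/andP: t01 => /ltW.
Qed.

Lemma integral_id_log_weight :
  (\int[mu]_(t in `]0%R, 1%R[) (t * log_weight t)%:E = (2^-1)%:E)%E.
Proof.
have m1 : measurable_fun (`]0%R, 1%R[%classic : set R)
  (fun t => (t * log_weight t)%:E).
  by apply/measurable_EFinP; apply: measurable_funM => //;
    exact: measurable_log_weight.
have m2 : measurable_fun (`]0%R, 1%R[%classic : set R)
  (fun t => ((1 - t) * log_weight t)%:E).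
  apply/measurable_EFinP; apply: measurable_funM;
    last exact: measurable_log_weight.
  exact: measurable_funB.
have p t : t \in `]0%R, 1%R[ ->
    (0 <= (t * log_weight t)%:E /\ 0 <= ((1 - t) * log_weight t)%:E)%E.
  rewrite in_itv/= !lee_fin => t01; have /andP[t0 t1] := t01.
  by rewrite !mulr_ge0 ?(ltW (log_weight_gt0 _))// ?subr_ge0 ltW.
have := integral_log_weight.
under eq_integral.
  move=> t _; rewrite -[log_weight t]mul1r -[X in X * _](subrK t) mulrDl EFinD.
  over.
rewrite ge0_integralD//; [|by move=> t /p[]|by move=> t /p[]].
rewrite integral_log_weight_onem.
(* Finiteness comes out of the equation itself: no infinite value added to itself gives 1. *)
case: (integral _ _ _) => //= r; rewrite -EFinD => -[] rr; congr (_%:E); lra.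
Qed.
End mass.

(** * Monotonicity and subtraction for integrals of extended-real functions *)

Section integral_lemmas.
Context d (T : measurableType d) (R : realType).
Context (mu : {measure set T -> \bar R}).
Local Open Scope ereal_scope.

(** The integrals of the positive and negative parts are suprema over the simple functions below
    them, so monotonicity holds for measurable and non-measurable functions alike. It is applied to
    harmonic and geometric means of arbitrary functionals. *)
Lemma le_integral_pointwise (D : set T) (f g : T -> \bar R) :
  {in D, forall x, f x <= g x} ->
  \int[mu]_(x in D) f x <= \int[mu]_(x in D) g x.
Proof.
move=> fg; have {}fg : {in setT, forall x, (f \_ D) x <= (g \_ D) x}.
  by move=> x _; rewrite /patch; case: ifPn => // /fg.
rewrite /integral; apply: leeB; apply: ereal_sup_le => _ [h hf <-];
  exists h => //= x.
  by rewrite (le_trans (hf x))// (funepos_le fg) ?inE.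
by rewrite (le_trans (hf x))// (funeneg_le fg) ?inE.
Qed.

(* The library's [oo - oo = -oo] makes [(f - g)^\+ + g = f + (f - g)^\-] hold
   even where [f] and [g] are infinite. *)
Lemma ge0_integralB (D : set T) (f g : T -> \bar R) : measurable D ->
  {in D, forall x, 0 <= f x} -> {in D, forall x, 0 <= g x} ->
  measurable_fun D f -> measurable_fun D g -> \int[mu]_(x in D) g x < +oo ->
  \int[mu]_(x in D) (f x - g x) = \int[mu]_(x in D) f x - \int[mu]_(x in D) g x.
Proof.
move=> mD f0 g0 mf mg goo; pose h x := f x - g x.
have mh : measurable_fun D h by exact: emeasurable_funB.
have mhp : measurable_fun D h^\+ by exact: measurable_funepos.
have mhn : measurable_fun D h^\- by exact: measurable_funeneg.
have hn_g : \int[mu]_(x in D) h^\- x <= \int[mu]_(x in D) g x.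
  apply: le_integral_pointwise => x xD; rewrite funenegE ge_max g0// andbT /h.
  by have := f0 _ xD; case: (f x) (g x) => [r| |] [s| |]//=;
    rewrite ?leey ?leNye// -?EFinB -?EFinN !lee_fin; lra.
have E : \int[mu]_(x in D) h^\+ x + \int[mu]_(x in D) g x =
    \int[mu]_(x in D) f x + \int[mu]_(x in D) h^\- x.
  rewrite -!ge0_integralD//; try by [move=> x /mem_set/f0|move=> x /mem_set/g0].
  apply: eq_integral => x xD; rewrite funeposE funenegE /h.
  have := f0 _ xD; have := g0 _ xD.
  case: (f x) (g x) => [r| |] [s| |]//= s0 r0.
  - have [sr|rs] := leP s r.
      rewrite max_l ?lee_fin ?subr_ge0// max_r ?lee_fin ?oppr_le0 ?subr_ge0//.
      by rewrite -!EFinD subrK addr0.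
    rewrite max_r ?lee_fin ?subr_le0 ?ltW// max_l ?lee_fin ?oppr_ge0 ?subr_le0
      ?ltW//.
    by rewrite add0e -EFinD opprB addrC subrK.
  - by rewrite addeNy max_r ?leNye// max_l ?leey.
  - by rewrite [maxe -oo _]max_r ?leNye// adde0 addye// max_l ?leey.
  - by rewrite addeNy max_r ?leNye// max_l ?leey.
rewrite [LHS](integralE _ _ h).
have : 0 <= \int[mu]_(x in D) h^\- x by exact: integral_ge0.
have : 0 <= \int[mu]_(x in D) g x by apply: integral_ge0 => x /mem_set/g0.
move: goo (le_lt_trans hn_g goo) E.
move: (\int[mu]_(x in D) h^\+ x) (\int[mu]_(x in D) f x) => A B.
case: (\int[mu]_(x in D) g x) => [g'| |]//;
  case: (\int[mu]_(x in D) h^\- x) => [n'| |]//.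
case: A B => [a| |] [b| |]//= _ _ + _ _; rewrite -!EFinD => -[] E;
  congr (_%:E); lra.
Qed.
End integral_lemmas.

(** * The mean against [log_weight], and Tonelli's theorem *)

Section mean.
Context {R : realType}.
Local Notation mu := (@lebesgue_measure R).
Local Notation I01 := (`]0%R, 1%R[%classic : set R).
Local Open Scope ereal_scope.
Implicit Types (phi psi : R -> \bar R).

Definition mean phi : \bar R := \int[mu]_(t in I01) ((log_weight t)%:E * phi t).

Lemma measurable_I01 : measurable I01. Proof. exact: measurable_itv. Qed.

Lemma log_weightE_ge0 t : I01 t -> 0 <= (log_weight t)%:E.
Proof. by rewrite /= in_itv/= lee_fin => /log_weight_gt0/ltW. Qed.

Lemma measurable_log_weightE : measurable_fun I01 (fun t => (log_weight t)%:E).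
Proof. by apply/measurable_EFinP; exact: measurable_log_weight. Qed.

Lemma geom_weight_ge0 (l t : R) : I01 l -> (0 <= geom_weight l t)%R.
Proof.
rewrite /= in_itv/= => /andP[l0 l1]; apply: mulr_ge0; last exact: expR_ge0.
apply: divr_ge0; last exact: pi_ge0.
by apply: sin_ge0_pi; rewrite mulr_ge0 ?pi_ge0 ?(ltW l0)//= ger_pMr ?pi_gt0//
  ltW.
Qed.

Lemma measurable_geom_weight : measurable_fun [set: R * R]
  (fun z => geom_weight z.1 z.2).
Proof.
apply: measurable_funM.
  apply: measurable_funM => //.
  apply: (measurableT_comp (f := @sin R)).
    by apply: continuous_measurable_fun; exact: continuous_sin.
  exact: measurable_funM.
apply: measurableT_comp => //.
apply: measurable_funB; apply: measurable_funM => //.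
- exact: measurable_funB.
- exact: measurableT_comp.
- by apply: measurableT_comp => //; exact: measurable_funB.
Qed.

Lemma measurable_geom_weightl (t : R) :
  measurable_fun [set: R] (geom_weight ^~ t).
Proof.
by apply: (measurableT_comp measurable_geom_weight (g := fun l => (l, t)));
  exact: measurable_fun_pair.
Qed.

Lemma measurable_geom_weightr (l : R) : measurable_fun [set: R] (geom_weight l).
Proof.
by apply: (measurableT_comp measurable_geom_weight (g := fun t => (l, t)));
  exact: measurable_fun_pair.
Qed.

Let smear psi (l : R) := \int[mu]_(t in I01) ((geom_weight l t)%:E * psi t).

(** Cut off outside the open square, because Tonelli's theorem is applied on the whole plane and
    [sin (pi * l)] changes sign there. *)
Let F psi : R * R -> \bar R :=
  (fun z => (geom_weight z.1 z.2)%:E * psi z.2) \_ (I01 `*` I01).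

Let F_ge0 psi : (forall t, 0 <= psi t) -> forall z, 0 <= F psi z.
Proof.
move=> p0 z; apply: erestrict_ge0 => -[l t] [/= l01 _].
by rewrite mule_ge0// lee_fin geom_weight_ge0.
Qed.

Let measurable_F psi :
  measurable_fun I01 psi -> measurable_fun [set: R * R] (F psi).
Proof.
move=> mp.
apply/(measurable_restrictT _ (measurableX measurable_I01 measurable_I01)).
apply: emeasurable_funM.
  apply/measurable_EFinP; apply: measurable_funTS;
    exact: measurable_geom_weight.
apply: (measurable_comp (F := I01)) => //.
- by move=> _ [[l t] [_ /= t01] <-].
- exact: measurable_funTS.
Qed.

Let smearE psi l : (\int[mu]_t F psi (l, t)) = (smear psi \_ I01) l.
Proof.
rewrite /F/= [RHS]patchE; case: ifPn => [/set_mem l01|l01].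
  rewrite /smear [RHS]integral_mkcond; apply: eq_integral => t _.
  by rewrite !patchE in_setX/= (mem_set l01).
apply: integral0_eq => t _; rewrite patchE in_setX/=.
by rewrite (negbTE l01).
Qed.

Let measurable_smear psi : (forall t, 0 <= psi t) -> measurable_fun I01 psi ->
  measurable_fun I01 (smear psi).
Proof.
move=> p0 mp; apply/(measurable_restrictT _ measurable_I01).
rewrite (_ : _ \_ _ = fun l => \int[mu]_t F psi (l, t)).
  by apply: (@measurable_fun_fubini_tonelli_F _ _ _ _ _ mu (F psi));
    [exact: measurable_F|exact: F_ge0].
by apply/funext => l; rewrite smearE.
Qed.

Let integral_smear psi : (forall t, 0 <= psi t) -> measurable_fun I01 psi ->
  \int[mu]_(l in I01) smear psi l = mean psi.
Proof.
move=> p0 mp; rewrite integral_mkcond.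
under eq_integral do rewrite -smearE.
rewrite (@fubini_tonelli _ _ _ _ _ mu mu (F psi));
  [|exact: measurable_F|exact: F_ge0].
rewrite /mean [RHS]integral_mkcond; apply: eq_integral => t _.
rewrite patchE; case: ifPn => [/set_mem t01|t01]; last first.
  by apply: integral0_eq => l _; rewrite /F patchE in_setX/= (negbTE t01) andbF.
rewrite -integral_geom_weight; last by move: t01; rewrite /= in_itv.
rewrite -ge0_integralZr//.
- rewrite [RHS]integral_mkcond; apply: eq_integral => l _.
  by rewrite /F !patchE in_setX/= (mem_set t01) andbT.
- apply/measurable_EFinP; apply: measurable_funTS.
  exact: measurable_geom_weightl.
- by move=> l l01; rewrite lee_fin geom_weight_ge0.
Qed.

Lemma mean_le phi psi :
  {in I01, forall t, phi t <= psi t} -> mean phi <= mean psi.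
Proof.
move=> pp; apply: le_integral_pointwise => t t01; apply: lee_wpmul2l;
  last exact: pp.
by apply: log_weightE_ge0; exact: set_mem.
Qed.

Lemma mean_cst (a : R) : (0 <= a)%R -> mean (cst a%:E) = a%:E.
Proof.
move=> a0; rewrite /mean ge0_integralZr ?integral_log_weight ?mul1e//.
- exact: measurable_log_weightE.
- exact: log_weightE_ge0.
Qed.

(** Tonelli's theorem applies to [phi^\+] and [phi^\-] separately. The lower bound makes the mean of
    [phi^\-] finite, so the results can be subtracted even when the mean of [phi^\+] is infinite.
    Prescribing [e] on the open interval leaves room for the conventions at 0 and 1. *)
Lemma integral_geom_mean phi (M : R) (e : R -> \bar R) :
  measurable_fun I01 phi ->
  {in I01, forall t, (- M)%:E <= phi t} ->
  {in I01, forall l, e l = (sin (pi * l) / pi)%:E *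
     \int[mu]_(t in I01) ((t `^ (l - 1) / (1 - t) `^ l)%:E * phi t)} ->
  \int[mu]_(l in `[0%R, 1%R]) e l = mean phi.
Proof.
move=> mphi phiM eE.
have mp : measurable_fun I01 phi^\+ by exact: measurable_funepos.
have mn : measurable_fun I01 phi^\- by exact: measurable_funeneg.
have {}eE : {in I01, forall l, e l = smear phi^\+ l - smear phi^\- l}.
  move=> l l01; rewrite eE//; have := set_mem l01;
    rewrite /= in_itv/= => /andP[l0 l1].
  set c := (sin _ / pi)%R; have c0 : (0 < c)%R.
    rewrite divr_gt0 ?pi_gt0// sin_gt0_pi// mulr_gt0 ?pi_gt0//=.
    by rewrite gtr_pMr ?pi_gt0.
  have wE psi : (forall t, 0 <= psi t) -> measurable_fun I01 psi ->
      \int[mu]_(t in I01) ((t `^ (l - 1) / (1 - t) `^ l)%:E * psi t) =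
        (c^-1)%:E * smear psi l.
    move=> p0 mpsi; rewrite /smear -ge0_integralZl_EFin//.
    - apply: eq_integral => t /set_mem; rewrite /= in_itv/= => t01.
      by rewrite muleA -EFinM -geom_weightE// mulKf ?gt_eqF.
    - by move=> t _; rewrite mule_ge0// lee_fin geom_weight_ge0//;
        exact: set_mem.
    - apply: emeasurable_funM => //; apply/measurable_EFinP;
        apply: measurable_funTS.
      exact: measurable_geom_weightr.
    - by rewrite invr_ge0 ltW.
  rewrite integralE.
  have w0 t : (0 <= t `^ (l - 1) / (1 - t) `^ l)%R.
    by rewrite divr_ge0 ?powR_ge0.
  rewrite [X in X - _](_ : _ = (c^-1)%:E * smear phi^\+ l); last first.
    rewrite -wE//; apply: eq_integral => t _.
    by rewrite !funeposE maxe_pMr ?mule0 ?lee_fin.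
  rewrite [X in _ - X](_ : _ = (c^-1)%:E * smear phi^\- l); last first.
    rewrite -wE//; apply: eq_integral => t _.
    by rewrite !funenegE maxe_pMr ?mule0 ?muleN ?lee_fin.
  have : 0 <= smear phi^\+ l.
    apply: integral_ge0 => t _; rewrite mule_ge0// lee_fin geom_weight_ge0//;
      exact: set_mem.
  have : 0 <= smear phi^\- l.
    apply: integral_ge0 => t _; rewrite mule_ge0// lee_fin geom_weight_ge0//;
      exact: set_mem.
  (* Either integral might be infinite for a given [l]; the positive factors [c^-1] and [c] commute
     with the subtraction in every case, including [oo - oo = -oo]. *)
  case: (smear _ _) => [n| |]//; case: (smear _ _) => [p| |]// _ _;
    rewrite -?EFinM -?EFinB -?EFinM.
  - by rewrite -mulrBr mulVKf// gt_eqF.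
  - by rewrite ?gt0_muley ?lte_fin ?invr_gt0//= gt0_muley.
  - by rewrite ?gt0_muley ?lte_fin ?invr_gt0//= gt0_muleNy.
  - by rewrite ?gt0_muley ?lte_fin ?invr_gt0//= gt0_muleNy.
have sp := measurable_smear (@funepos_ge0 _ _ phi) mp.
have sn := measurable_smear (@funeneg_ge0 _ _ phi) mn.
rewrite integral_itv_bndoo; last first.
  apply: (eq_measurable_fun (fun l => smear phi^\+ l - smear phi^\- l)).
    by move=> l l01; rewrite -eE.
  exact: emeasurable_funB.
transitivity (\int[mu]_(l in I01) (smear phi^\+ l - smear phi^\- l)).
  by apply: eq_integral => l l01; rewrite eE.
have M0 : 0 <= `|M|%:E by rewrite lee_fin.
rewrite ge0_integralB//.
- rewrite !integral_smear// [RHS]integralE; congr (_ - _);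
    apply: eq_integral => t t01.
    by rewrite !funeposE maxe_pMr ?mule0 ?log_weightE_ge0//; exact: set_mem.
  by rewrite !funenegE maxe_pMr ?mule0 ?muleN ?log_weightE_ge0//;
    exact: set_mem.
- move=> l l01; apply: integral_ge0 => t _; rewrite mule_ge0//
    lee_fin geom_weight_ge0//; exact: set_mem.
- move=> l l01; apply: integral_ge0 => t _; rewrite mule_ge0//
    lee_fin geom_weight_ge0//; exact: set_mem.
- rewrite integral_smear//; apply: (@le_lt_trans _ _ `|M|%:E); last exact: ltry.
  rewrite -[leRHS]mean_cst//; apply: mean_le => t t01.
  rewrite funenegE ge_max; apply/andP; split => //.
  rewrite leeNl (le_trans _ (phiM _ t01))// lee_fin lerN2; exact: ler_norm.
Qed.
End mean.

(** * Linearity and monotone convergence for the mean *)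

Section mean_theory.
Context {R : realType}.
Local Notation mu := (@lebesgue_measure R).
Local Notation I01 := (`]0%R, 1%R[%classic : set R).
Local Open Scope ereal_scope.
Implicit Types (phi psi : R -> \bar R).

Lemma ge0_mean_comb (p q : R) phi psi : (0 <= p)%R -> (0 <= q)%R ->
  measurable_fun I01 phi -> measurable_fun I01 psi ->
  {in I01, forall t, 0 <= phi t} -> {in I01, forall t, 0 <= psi t} ->
  mean (fun t => p%:E * phi t + q%:E * psi t) =
  p%:E * mean phi + q%:E * mean psi.
Proof.
move=> p0 q0 mphi mpsi phi0 psi0.
have mO := @measurable_log_weightE R.
have Ophi t : I01 t -> 0 <= (log_weight t)%:E * phi t.
  by move=> t01; rewrite mule_ge0 ?log_weightE_ge0// phi0//; exact: mem_set.
have Opsi t : I01 t -> 0 <= (log_weight t)%:E * psi t.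
  by move=> t01; rewrite mule_ge0 ?log_weightE_ge0// psi0//; exact: mem_set.
have mp : measurable_fun I01 (fun t => (log_weight t)%:E * phi t).
  exact: emeasurable_funM.
have mq : measurable_fun I01 (fun t => (log_weight t)%:E * psi t).
  exact: emeasurable_funM.
rewrite /mean -!ge0_integralZl_EFin// -ge0_integralD//.
- apply: eq_integral => t t01; rewrite ge0_muleDr; last 2 first.
  + by rewrite mule_ge0 ?phi0.
  + by rewrite mule_ge0 ?psi0.
  by rewrite !(muleCA (log_weight t)%:E).
- by move=> t /Ophi; apply: mule_ge0.
- exact: measurable_funeM.
- by move=> t /Opsi; apply: mule_ge0.
- exact: measurable_funeM.
Qed.

Lemma eq_mean phi psi : {in I01, phi =1 psi} -> mean phi = mean psi.
Proof. by move=> pp; apply: eq_integral => t t01; rewrite pp. Qed.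

(** [mean phi] may be [+oo], so integrability cannot be relied on. As the mass is one, adding [M]
    inside and subtracting it outside reduces linearity and monotone convergence to nonnegative
    functions. *)
Lemma mean_shift phi (M : R) : (0 <= M)%R -> measurable_fun I01 phi ->
  {in I01, forall t, (- M)%:E <= phi t} ->
  mean phi = mean (fun t => phi t + M%:E) - M%:E.
Proof.
move=> M0 mphi phiM; rewrite -[X in _ - X]mean_cst//.
have mO := @measurable_log_weightE R.
rewrite [in RHS]/mean -ge0_integralB//.
- apply: eq_integral => t _; rewrite -muleBr//; last first.
    by rewrite fin_num_adde_defl.
  by rewrite addeK.
- move=> t t01; rewrite mule_ge0 ?log_weightE_ge0//; first exact: set_mem.
  by rewrite -leeBlDr// sub0e -EFinN phiM.
- by move=> t t01; rewrite mule_ge0 ?log_weightE_ge0//; exact: set_mem.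
- by apply: emeasurable_funM => //; exact: emeasurable_funD.
- exact: emeasurable_funM.
- by rewrite -/(mean _) mean_cst// ltry.
Qed.

Lemma mean_affine (a b : R) :
  mean (fun t => ((1 - t) * a + t * b)%:E) = ((a + b) / 2)%:E.
Proof.
pose M := (`|a| + `|b|)%R; have M0 : (0 <= M)%R by rewrite addr_ge0.
have aM : (0 <= a + M)%R.
  by have := ler_norm (- a)%R; have := normr_ge0 b; rewrite normrN /M; lra.
have bM : (0 <= b + M)%R.
  by have := ler_norm (- b)%R; have := normr_ge0 a; rewrite normrN /M; lra.
have m1 : measurable_fun I01 (fun t => (1 - t)%:E).
  by apply/measurable_EFinP; exact: measurable_funB.
have m2 : measurable_fun I01 (fun t => t%:E) by exact/measurable_EFinP.
have i01 t : t \in I01 -> (0 < t /\ t < 1)%R.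
  by move=> /set_mem; rewrite /= in_itv/= => /andP[].
rewrite (@mean_shift _ M)//; last 2 first.
- apply/measurable_EFinP; apply: measurable_funD; apply: measurable_funM => //.
  exact: measurable_funB.
- move=> t /i01[t0 t1]; rewrite lee_fin; nra.
rewrite (@eq_mean _ (fun t => (a + M)%:E * (1 - t)%:E + (b + M)%:E * t%:E));
  last first.
  by move=> t _; rewrite -!EFinM -!EFinD; congr (_%:E); ring.
rewrite ge0_mean_comb//; last 2 first.
- by move=> t /i01[t0 t1]; rewrite lee_fin subr_ge0 ltW.
- by move=> t /i01[t0 t1]; rewrite lee_fin ltW.
have -> : mean (fun t : R => t%:E) = (2^-1)%:E.
  by rewrite -integral_id_log_weight; apply: eq_integral => t _;
    rewrite -EFinM mulrC.
have -> : mean (fun t : R => (1 - t)%:E) = (2^-1)%:E.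
  rewrite -integral_id_log_weight -integral_log_weight_onem.
  by apply: eq_integral => t _; rewrite -EFinM mulrC.
by rewrite -!EFinM -!EFinD; congr (_%:E); rewrite /M; field.
Qed.

Lemma mean_comb (s M : R) phi psi : (0 < s < 1)%R -> (0 <= M)%R ->
  measurable_fun I01 phi -> measurable_fun I01 psi ->
  {in I01, forall t, (- M)%:E <= phi t} ->
  {in I01, forall t, (- M)%:E <= psi t} ->
  mean (fun t => (1 - s)%:E * phi t + s%:E * psi t) =
  (1 - s)%:E * mean phi + s%:E * mean psi.
Proof.
move=> /andP[s0 s1] M0 mphi mpsi phiM psiM.
have s'0 : (0 < 1 - s)%R by rewrite subr_gt0.
rewrite (@mean_shift _ M)//; last 2 first.
- by apply: emeasurable_funD; exact: measurable_funeM.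
- move=> t t01; rewrite (_ : - M = (1 - s) * (- M) + s * (- M))%R; last by ring.
  by rewrite EFinD !EFinM; apply: leeD; apply: lee_wpmul2l;
    rewrite ?lee_fin ?(ltW s0) ?(ltW s'0) ?phiM ?psiM.
rewrite (@eq_mean _ (fun t =>
  (1 - s)%:E * (phi t + M%:E) + s%:E * (psi t + M%:E))); last first.
  move=> t _; rewrite !muleDr ?fin_num_adde_defl// addeACA; congr (_ + _).
  by rewrite -!EFinM -EFinD; congr (_%:E); ring.
have shift0 chi : {in I01, forall t, (- M)%:E <= chi t} ->
    {in I01, forall t, 0 <= chi t + M%:E}.
  by move=> chiM t t01; rewrite -leeBlDr// sub0e -EFinN chiM.
rewrite ge0_mean_comb ?(ltW s0) ?(ltW s'0)//;
  [|exact: emeasurable_funD|exact: emeasurable_funD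
   |exact: shift0|exact: shift0].
rewrite (mean_shift M0 mphi phiM) (mean_shift M0 mpsi psiM).
move: (mean _) (mean _) => X Y.
rewrite !muleBr ?fin_num_adde_defl// ?fin_numN// addeACA; congr (_ + _).
by rewrite -!EFinM -!EFinN -EFinD; congr (_%:E); ring.
Qed.

Lemma mean_cvg (f : nat -> R -> R) phi (M : R) : (0 <= M)%R ->
  (forall n, measurable_fun I01 (f n)) ->
  (forall n, {in I01, forall t, - M <= f n t}%R) ->
  {in I01, forall t, nondecreasing_seq (f ^~ t)} ->
  {in I01, forall t, (f n t)%:E @[n --> \oo] --> phi t} ->
  mean (EFin \o f n) @[n --> \oo] --> mean phi.
Proof.
move=> M0 mf fM ndf cf.
have mO := @measurable_log_weightE R.
have mfE n : measurable_fun I01 (EFin \o f n) by apply/measurable_EFinP.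
have mphi : measurable_fun I01 phi.
  by apply: (emeasurable_fun_cvg (fun n => EFin \o f n)) => // t /mem_set/cf.
have phiM : {in I01, forall t, (- M)%:E <= phi t}.
  move=> t t01; rewrite -(cvg_lim _ (cf _ t01))//; apply: lime_ge.
    by apply/cvg_ex; exists (phi t); exact: cf.
  by apply: nearW => n; rewrite lee_fin fM.
have -> : (fun n => mean (EFin \o f n)) =
    (fun n => mean (fun t => (f n t)%:E + M%:E) - M%:E).
  apply/funext => n; rewrite (@mean_shift _ M)//= => t t01.
  by rewrite lee_fin fM.
rewrite (mean_shift M0 mphi phiM).
apply: cvgeB; [by rewrite fin_num_adde_defl| |exact: cvg_cst].
rewrite (_ : mean (fun t => phi t + M%:E) = \int[mu]_(t in I01)
  limn (fun n => (log_weight t)%:E * ((f n t)%:E + M%:E))); last first.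
  apply: eq_integral => t t01; apply/esym/cvg_lim => //.
  apply: cvgeZl => //; apply: cvgeD; [|exact: cf|exact: cvg_cst].
  by rewrite fin_num_adde_defl.
apply: cvg_monotone_convergence => //.
- by move=> n; apply: emeasurable_funM => //; apply: emeasurable_funD => //;
    exact: mfE.
- move=> n t t01; rewrite mule_ge0 ?log_weightE_ge0// -EFinD lee_fin -lerBlDr
    sub0r fM//; exact: mem_set.
- move=> t t01 m n mn; apply: lee_wpmul2l; first exact: log_weightE_ge0.
  by apply: leeD2r; rewrite lee_fin; apply: ndf => //; exact: mem_set.
Qed.
End mean_theory.

(** * Real parts, dual points and convex combinations *)

Section scalars.
Context {R : realType} {k : scalar_kind}.
Implicit Types (a : R) (z w : scalar_field R k).

Lemma re_partD z w : re_part k (z + w) = re_part k z + re_part k w.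
Proof. by case: k z w => //= -[a b] [c d]. Qed.

Lemma re_partB z w : re_part k (z - w) = re_part k z - re_part k w.
Proof. by case: k z w => //= -[a b] [c d]. Qed.

Lemma re_partZ a z : re_part k (of_real k a * z) = a * re_part k z.
Proof. by case: k z => //= -[b c]; rewrite /= mul0r subr0. Qed.

Lemma of_real_gt0 a : 0 < a -> 0 < of_real k a.
Proof. by case: k => //=; rewrite ltcR. Qed.

Lemma norm_re_part_lt z a : `|z| < of_real k a -> `|re_part k z| < a.
Proof.
case: k z => //= z; rewrite -ltcR; apply: le_lt_trans; exact: normc_ge_Re.
Qed.
End scalars.

Section dual_space.
Context {R : realType} {k : scalar_kind} {E : tvsType (scalar_field R k)}.
Implicit Types (p q : dual E) (x y : E) (s e : R).

Lemma re_dual_comb p x y s :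
  re_part k (p (of_real k (1 - s) *: x + of_real k s *: y)) =
  (1 - s) * re_part k (p x) + s * re_part k (p y).
Proof. by rewrite linearD !linearZ/= re_partD !re_partZ. Qed.

(** Conjugates see a dual point only through its real part. This is the competitor used for joint
    concavity. *)
Lemma dual_comb p q s : exists r : dual E, forall x,
  re_part k (r x) = (1 - s) * re_part k (p x) + s * re_part k (q x).
Proof.
pose f := (of_real k (1 - s) \*: dual_fun p \+ of_real k s \*: dual_fun q) :
  {linear E -> (scalar_field R k)^o}.
have cf : continuous f.
  by move=> x; apply: cvgD; apply: cvgZ;
    [exact: cvg_cst|exact: dual_continuous
    |exact: cvg_cst|exact: dual_continuous].
by exists (Dual cf) => x; rewrite /= re_partD !re_partZ.
Qed.

(** Supplies the common point that [conj_proper] asks for when both conjugates are below [+oo]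
    everywhere. *)
Lemma dual0 : exists p : dual E, forall x, re_part k (p x) = 0.
Proof.
have c0 : continuous (\0 : {linear E -> (scalar_field R k)^o}).
  by move=> x; exact: cvg_cst.
by exists (Dual c0) => x /=; case: k.
Qed.

Lemma re_dual_near p x e : 0 < e ->
  \forall y \near x, re_part k (p x) - e < re_part k (p y).
Proof.
move=> /(of_real_gt0 (k := k)) e0.
have /cvgrPdist_lt/(_ _ e0) := @dual_continuous _ _ _ p x.
apply: filterS => y /norm_re_part_lt; rewrite ltr_norml => /andP[_].
rewrite re_partB; lra.
Qed.
End dual_space.

Section convex_combinations.
Context {R : realType} {T : Type}.
Implicit Types (s a b : R) (u v : \bar R) (f g : T -> \bar R).

Lemma arith_meanE s f g x : 0 < s < 1 ->
  arith_mean s f g x = ((1 - s)%:E * f x + s%:E * g x)%dE.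
Proof. by move=> /andP[s0 s1]; rewrite /arith_mean gt_eqF// lt_eqF. Qed.

Lemma arith_mean_fin s f g x a b : 0 < s < 1 ->
  f x = a%:E -> g x = b%:E -> arith_mean s f g x = ((1 - s) * a + s * b)%:E.
Proof. by move=> s01 fx gx; rewrite arith_meanE// fx gx. Qed.

Lemma arith_mean_def s f g x : 0 < s < 1 -> f x != -oo%E -> g x != -oo%E ->
  arith_mean s f g x = ((1 - s)%:E * f x + s%:E * g x)%E.
Proof.
move=> s01 fx gx; rewrite arith_meanE//; have /andP[s0 s1] := s01.
apply: dual_addeE_def; have s'0 : 0 < 1 - s by rewrite subr_gt0.
by move: (f x) (g x) fx gx => [a| |] [b| |]// _ _;
  rewrite ?gt0_muley ?lte_fin.
Qed.

Lemma le_arith_mean s f g f' g' x y : 0 < s < 1 -> (f x <= f' y)%E ->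
  (g x <= g' y)%E -> (arith_mean s f g x <= arith_mean s f' g' y)%E.
Proof.
move=> s01 ff gg; rewrite !arith_meanE//; have /andP[s0 s1] := s01.
by apply: lee_dD; apply: lee_wpmul2l; rewrite ?lee_fin ?subr_ge0 ?(ltW s0)
  ?(ltW s1).
Qed.

Lemma arith_meany s f g x : 0 < s < 1 -> f x = +oo%E \/ g x = +oo%E ->
  arith_mean s f g x = +oo%E.
Proof.
move=> s01 fg; rewrite arith_meanE//; have /andP[s0 s1] := s01.
have s'0 : 0 < 1 - s by rewrite subr_gt0.
case: fg => ->; rewrite gt0_muley ?lte_fin//.
exact: daddey.
Qed.
End convex_combinations.

(** * Countable families and running maxima *)

Section running_maximum.
Context {R : realType}.
Implicit Types (u : nat -> R) (a b : R).

(** Makes a sequence nondecreasing without changing its supremum; by [runmaxP] each term is still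
    the value at one index, hence later at one dual point. *)
Fixpoint runmax (u : nat -> R) n : R :=
  if n is m.+1 then Num.max (runmax u m) (u n) else u 0%N.

Lemma le_runmax u n : u n <= runmax u n.
Proof. by case: n => //= n; rewrite le_max lexx orbT. Qed.

Lemma runmax_nd u m n : (m <= n)%N -> runmax u m <= runmax u n.
Proof.
by move: m n; apply/nondecreasing_seqP => n /=; rewrite le_max lexx.
Qed.

Lemma runmaxP u n : exists2 i, (i <= n)%N & runmax u n = u i.
Proof.
elim: n => [|n [i ni IH]]; first by exists 0%N.
rewrite /=; case: leP => _; first by exists n.+1.
by exists i => //; exact: leqW.
Qed.

(** Countability comes from the rational pairs, not from [T]: each pair strictly below some [A q],
    [B q] is assigned one such [q]. A rational pair squeezed between [a], [b] and [A q], [B q] gives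
    the index; [q0] is the default value. *)
Lemma countable_dominating_family (T : Type) (P : T -> Prop) (A B : T -> R)
    (q0 : T) :
  P q0 -> exists p : nat -> T, (forall n, P (p n)) /\
    forall q a b, P q -> a < A q -> b < B q ->
      exists n, a < A (p n) /\ b < B (p n).
Proof.
move=> Pq0.
have H (r : rat * rat) : exists q, P q /\
    ((exists q', [/\ P q', ratr r.1 < A q' & ratr r.2 < B q']) ->
     ratr r.1 < A q /\ ratr r.2 < B q).
  have [[q [Pq ? ?]]|nq] :=
      pselect (exists q', [/\ P q', ratr r.1 < A q' & ratr r.2 < B q']).
    by exists q.
  by exists q0.
have [F FP] := choice H.
exists (fun n => if unpickle n is Some r then F r else q0); split.
  by move=> n; case: unpickle => // r; have [] := FP r.
move=> q a b Pq aq bq.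
have [c /andP[ac cA]] : exists c : rat, a < ratr c < A q.
  by have [c] := rat_in_itvoo aq; rewrite in_itv/=; exists c.
have [d /andP[bd dB]] : exists d : rat, b < ratr d < B q.
  by have [d] := rat_in_itvoo bq; rewrite in_itv/=; exists d.
exists (pickle (c, d)); rewrite pickleK.
have [_ []] := FP (c, d); first by exists q.
by move=> cF dF; rewrite (lt_trans ac cF) (lt_trans bd dF).
Qed.

End running_maximum.

(** * Harmonic means as suprema of functions affine in [t] *)

Section conjugates.
Context {R : realType} {k : scalar_kind} {E : tvsType (scalar_field R k)}.
Implicit Types (f g : E -> \bar R) (p q : dual E) (x y : E) (s t a b : R).
Local Notation re := (re_part k).

Lemma conjugate_ge f p x : ((re (p x))%:E - f x <= conjugate f p)%E.
Proof. by apply: ereal_sup_ubound; exists x. Qed.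

Lemma le_conjugate f g p : pointwise_le f g ->
  (conjugate g p <= conjugate f p)%E.
Proof.
move=> fg; apply: ge_ereal_sup => _ [x _ <-].
by apply: le_trans (conjugate_ge f p x); apply: leeB.
Qed.

Lemma conjugate_gtNy f p : (exists x, f x != +oo%E) -> conjugate f p != -oo%E.
Proof.
move=> [x fx]; rewrite -ltNye; apply: lt_le_trans (conjugate_ge f p x).
by case: (f x) fx => [r| |]//= _; rewrite -?EFinB ?ltNyr.
Qed.

Lemma fenchel_young f p x a :
  (conjugate f p <= a%:E)%E -> ((re (p x) - a)%:E <= f x)%E.
Proof.
move=> /(le_trans (conjugate_ge f p x)); case: (f x) => [r| |]//=.
  by rewrite -EFinB !lee_fin; lra.
by rewrite leey.
Qed.

Lemma harm_meanE t f g x : 0 < t < 1 ->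
  harm_mean t f g x = ereal_sup (range (fun p : dual E =>
    ((re (p x))%:E - arith_mean t (conjugate f) (conjugate g) p)%E)).
Proof. by move=> /andP[t0 t1]; rewrite /harm_mean gt_eqF// lt_eqF. Qed.

Lemma harm_mean_ge t f g x p a b : 0 < t < 1 ->
  (conjugate f p <= a%:E)%E -> (conjugate g p <= b%:E)%E ->
  ((re (p x) - ((1 - t) * a + t * b))%:E <= harm_mean t f g x)%E.
Proof.
move=> t01 fa gb; rewrite harm_meanE// EFinB.
apply: (@le_trans _ _
  ((re (p x))%:E - arith_mean t (conjugate f) (conjugate g) p)%E).
  apply: leeB => //.
  rewrite -(@arith_mean_fin _ _ t (fun=> a%:E) (fun=> b%:E) p)//.
  exact: le_arith_mean.
by apply: ereal_sup_ubound; exists p.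
Qed.

(** Where one conjugate is [+oo], the convention [a + (+oo) = +oo] turns the term of the supremum
    into [-oo]. *)
Lemma harm_mean_le t f g x (c : \bar R) : 0 < t < 1 ->
  (forall p, conjugate f p != -oo%E) -> (forall p, conjugate g p != -oo%E) ->
  (forall p a b, conjugate f p = a%:E -> conjugate g p = b%:E ->
    ((re (p x) - ((1 - t) * a + t * b))%:E <= c)%E) ->
  (harm_mean t f g x <= c)%E.
Proof.
move=> t01 fNy gNy H; rewrite harm_meanE//; apply: ge_ereal_sup => _ [p _ <-].
have [f' | f'] := eqVneq (conjugate f p) +oo%E.
  by rewrite arith_meany ?leNye//; left.
have [g' | g'] := eqVneq (conjugate g p) +oo%E.
  by rewrite arith_meany ?leNye//; right.
have := H p; have := fNy p; have := gNy p.
case fp : (conjugate f p) f' => [a| |]// _;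
  case gp : (conjugate g p) g' => [b| |]// _.
move=> _ _ /(_ _ _ erefl erefl).
by rewrite (arith_mean_fin t01 fp gp).
Qed.

Lemma le_harm_mean t f1 f2 g1 g2 x : 0 < t < 1 ->
  pointwise_le f1 f2 -> pointwise_le g1 g2 ->
  (harm_mean t f1 g1 x <= harm_mean t f2 g2 x)%E.
Proof.
move=> t01 f12 g12; rewrite !harm_meanE//; apply: ge_ereal_sup => _ [p _ <-].
apply: le_trans; last by apply: ereal_sup_ubound; exists p.
by apply: leeB => //; apply: le_arith_mean => //; exact: le_conjugate.
Qed.

(** Together the three conditions give a dual point with both conjugates finite, hence a finite
    affine minorant of the harmonic means. If only the third fails, [log_mean f g] is [-oo]. *)
Definition conj_proper f g := [/\ forall p, conjugate f p != -oo%E,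
  forall p, conjugate g p != -oo%E &
  edom (conjugate f) `&` edom (conjugate g) !=set0].

Definition affine_val f g p x t : R :=
  re (p x) - ((1 - t) * fine (conjugate f p) + t * fine (conjugate g p)).

Definition sup_seq f g (p : nat -> dual E) x t : nat -> R :=
  runmax (fun i => affine_val f g (p i) x t).

(** The family [p] is chosen before [t]. This is possible because [affine_val] is nondecreasing in
    the two reals [re (q x) - fine (conjugate f q)] and [re (q x) - fine (conjugate g q)], neither
    of which involves [t]. *)
Lemma harm_mean_cvg f g x : conj_proper f g -> exists p : nat -> dual E,
  (forall n,
    conjugate f (p n) \is a fin_num /\ conjugate g (p n) \is a fin_num) /\
  forall t, 0 < t < 1 ->
    (sup_seq f g p x t n)%:E @[n --> \oo] --> harm_mean t f g x.
Proof.
move=> [fNy gNy [q0 [fq0 gq0]]].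
have finE f' p : (forall p, conjugate f' p != -oo%E) ->
    (conjugate f' p < +oo)%E -> conjugate f' p \is a fin_num.
  by move=> Ny ly; rewrite fin_numE Ny/= -ltey.
pose P p := conjugate f p \is a fin_num /\ conjugate g p \is a fin_num.
have Pq0 : P q0 by split; exact: finE.
have [p [Pp pP]] := countable_dominating_family
  (fun q => re (q x) - fine (conjugate f q))
  (fun q => re (q x) - fine (conjugate g q)) Pq0.
exists p; split => // t t01; have /andP[t0 t1] := t01.
rewrite (_ : harm_mean t f g x =
  ereal_sup (range (fun n => (sup_seq f g p x t n)%:E))).
  apply: ereal_nondecreasing_cvgn => m n mn; rewrite lee_fin; exact: runmax_nd.
apply/eqP; rewrite eq_le; apply/andP; split; last first.
  apply: ge_ereal_sup => _ [n _ <-];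
    have [i _ e] := runmaxP (fun i => affine_val f g (p i) x t) n.
  rewrite /sup_seq e.
  by apply: harm_mean_ge => //; have [? ?] := Pp i; rewrite fineK.
apply: harm_mean_le => // q a b fa gb.
(* The family dominates strict minorants of a pair, whence a loss of [e] in both coordinates. *)
apply/lee_addgt0Pr => e e0; rewrite -leeBlDr// -EFinB.
have Pq : P q by rewrite /P fa gb.
have [||n []] := pP q (re (q x) - a - e) (re (q x) - b - e) Pq.
- by rewrite fa/=; lra.
- by rewrite gb/=; lra.
move=> An Bn; apply: (@le_trans _ _ (sup_seq f g p x t n)%:E).
  rewrite lee_fin.
  apply: le_trans (le_runmax (fun i => affine_val f g (p i) x t) n).
  rewrite /affine_val; nra.
by apply: ereal_sup_ubound; exists n.
Qed.
End conjugates.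

(** * Integral formula and bounds for the logarithmic mean *)

Section log_mean_theory.
Context {R : realType} {k : scalar_kind} {E : tvsType (scalar_field R k)}.
Implicit Types (f g : E -> \bar R) (p q : dual E) (x y : E) (s t a b : R).
Implicit Types (phi : R -> \bar R).
Local Notation re := (re_part k).
Local Notation mu := (@lebesgue_measure R).
Local Notation I01 := (`]0%R, 1%R[%classic : set R).

Lemma I01P t : t \in I01 -> 0 < t < 1.
Proof. by move=> /set_mem; rewrite /= in_itv. Qed.

Lemma measurable_sup_seq f g (p : nat -> dual E) x n :
  measurable_fun I01 (fun t => sup_seq f g p x t n).
Proof.
have ma i : measurable_fun I01 (affine_val f g (p i) x).
  apply: measurable_funB => //; apply: measurable_funD;
    apply: measurable_funM => //.
  exact: measurable_funB.
elim: n => [|n IH]; first exact: ma.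
exact: measurable_maxr.
Qed.

(** A running maximum stays above its first term, here affine in [t] with end values [A] and [B]; so
    the bound is uniform in [n] and [t]. *)
Lemma sup_seq_lb f g (p : nat -> dual E) x : exists M, 0 <= M /\
  forall n, {in I01, forall t, - M <= sup_seq f g p x t n}.
Proof.
pose A := re (p 0%N x) - fine (conjugate f (p 0%N)).
pose B := re (p 0%N x) - fine (conjugate g (p 0%N)).
exists (`|A| + `|B|); split=> [|n t /I01P/andP[t0 t1]];
  first by rewrite addr_ge0.
apply: (@le_trans _ _ (affine_val f g (p 0%N) x t)); last first.
  exact: (@runmax_nd _ (fun i => affine_val f g (p i) x t) 0 n).
have -> : affine_val f g (p 0%N) x t = (1 - t) * A + t * B.
  by rewrite /affine_val /A /B; ring.
have := ler_norm (- A); have := ler_norm (- B); rewrite !normrN => hB hA.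
have := normr_ge0 A; have := normr_ge0 B; nra.
Qed.

Lemma measurable_harm_mean f g x : conj_proper f g ->
  measurable_fun I01 (fun t => harm_mean t f g x).
Proof.
move=> /(harm_mean_cvg x)[p [_ pc]].
apply: (emeasurable_fun_cvg (fun n t => (sup_seq f g p x t n)%:E)) => [n|t t01].
  by apply/measurable_EFinP; exact: measurable_sup_seq.
by apply: pc; apply: I01P; exact: mem_set.
Qed.

Lemma harm_mean_lb f g x : conj_proper f g -> exists M, 0 <= M /\
  {in I01, forall t, ((- M)%:E <= harm_mean t f g x)%E}.
Proof.
move=> /(harm_mean_cvg x)[p [_ pc]]; have [M [M0 pM]] := sup_seq_lb f g p x.
exists M; split=> // t t01; have ct := pc _ (I01P t01).
rewrite -(cvg_lim _ ct)//; apply: lime_ge; first by apply/cvg_ex; eexists;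
  exact: ct.
by apply: nearW => n; rewrite lee_fin pM.
Qed.

Lemma geom_meanE t f g x : 0 < t < 1 ->
  geom_mean t f g x = ((sin (pi * t) / pi)%:E *
    \int[mu]_(u in I01)
      ((u `^ (t - 1) / (1 - u) `^ t)%:E * harm_mean u f g x))%E.
Proof. by move=> /andP[t0 t1]; rewrite /geom_mean gt_eqF// lt_eqF. Qed.

Lemma le_weighted_integral t (phi psi : R -> \bar R) : 0 < t < 1 ->
  {in I01, forall u, phi u <= psi u}%E ->
  ((sin (pi * t) / pi)%:E *
     \int[mu]_(u in I01) ((u `^ (t - 1) / (1 - u) `^ t)%:E * phi u) <=
   (sin (pi * t) / pi)%:E *
     \int[mu]_(u in I01) ((u `^ (t - 1) / (1 - u) `^ t)%:E * psi u))%E.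
Proof.
move=> /andP[t0 t1] pp; apply: lee_wpmul2l.
  rewrite lee_fin divr_ge0 ?pi_ge0// sin_ge0_pi// mulr_ge0 ?pi_ge0 ?(ltW t0)//=.
  by rewrite ger_pMr ?pi_gt0// ltW.
apply: le_integral_pointwise => u u01; apply: lee_wpmul2l; last exact: pp.
by rewrite lee_fin divr_ge0 ?powR_ge0.
Qed.

(* At [l = 0] and [l = 1] the means are [f x] and [g x] by convention, whatever
   [phi] is. *)
Let extend phi f g x l : \bar R := if 0 < l < 1 then
    ((sin (pi * l) / pi)%:E *
      \int[mu]_(u in I01) ((u `^ (l - 1) / (1 - u) `^ l)%:E * phi u))%E
  else geom_mean l f g x.

Let mean_extend phi f g x M : measurable_fun I01 phi ->
  {in I01, forall t, (- M)%:E <= phi t}%E ->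
  (\int[mu]_(l in `[0%R, 1%R]) extend phi f g x l)%E = mean phi.
Proof.
move=> mphi phiM; apply: integral_geom_mean mphi phiM _ => l /I01P l01.
by rewrite /extend l01.
Qed.

(** Measurability and the lower bound are asked of the comparison function, so that the estimate
    also covers harmonic means without a lower bound, as in [log_mean_Ny]. *)
Lemma log_mean_le phi f g x M : measurable_fun I01 phi ->
  {in I01, forall t, (- M)%:E <= phi t}%E ->
  {in I01, forall t, harm_mean t f g x <= phi t}%E ->
  (log_mean f g x <= mean phi)%E.
Proof.
move=> mphi phiM hphi; rewrite -(mean_extend f g x mphi phiM).
apply: le_integral_pointwise => l _; rewrite /extend; case: ifPn => // l01.
by rewrite geom_meanE//; exact: le_weighted_integral.
Qed.

Lemma log_mean_ge phi f g x M : measurable_fun I01 phi ->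
  {in I01, forall t, (- M)%:E <= phi t}%E ->
  {in I01, forall t, phi t <= harm_mean t f g x}%E ->
  (mean phi <= log_mean f g x)%E.
Proof.
move=> mphi phiM hphi; rewrite -(mean_extend f g x mphi phiM).
apply: le_integral_pointwise => l _; rewrite /extend; case: ifPn => // l01.
by rewrite geom_meanE//; exact: le_weighted_integral.
Qed.

Lemma log_meanE f g x : conj_proper f g ->
  log_mean f g x = mean (fun t => harm_mean t f g x).
Proof.
move=> fg; have [M [_ hM]] := harm_mean_lb x fg;
  have mh := measurable_harm_mean x fg.
by apply/eqP; rewrite eq_le (log_mean_le mh hM)// (log_mean_ge mh hM).
Qed.

Lemma le_log_mean f1 f2 g1 g2 x : pointwise_le f1 f2 -> pointwise_le g1 g2 ->
  (log_mean f1 g1 x <= log_mean f2 g2 x)%E.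
Proof.
move=> f12 g12; apply: le_integral_pointwise => l /set_mem;
  rewrite /= in_itv/= => /andP[l0 l1].
have [->|ln0] := eqVneq l 0; first by rewrite /geom_mean eqxx; exact: f12.
have [->|ln1] := eqVneq l 1; first by rewrite /geom_mean oner_eq0 eqxx;
  exact: g12.
have l01 : 0 < l < 1 by rewrite lt_neqAle eq_sym ln0 l0 lt_neqAle ln1.
rewrite (geom_meanE f1 g1 x l01) (geom_meanE f2 g2 x l01).
apply: (@le_weighted_integral l _ _ l01) => u /I01P u01.
exact: le_harm_mean.
Qed.

Lemma affine_lb a b :
  {in I01, forall t, (- (`|a| + `|b|))%:E <= ((1 - t) * a + t * b)%:E}%E.
Proof.
move=> t /I01P/andP[t0 t1]; rewrite lee_fin.
have := ler_norm (- a); have := ler_norm (- b); rewrite !normrN => hB hA.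
have := normr_ge0 a; have := normr_ge0 b; nra.
Qed.

Lemma measurable_affine a b :
  measurable_fun I01 (fun t => ((1 - t) * a + t * b)%:E).
Proof.
apply/measurable_EFinP; apply: measurable_funD; apply: measurable_funM => //.
exact: measurable_funB.
Qed.

Lemma log_mean_le_affine f g x a b :
  {in I01, forall t, harm_mean t f g x <= ((1 - t) * a + t * b)%:E}%E ->
  (log_mean f g x <= ((a + b) / 2)%:E)%E.
Proof.
by rewrite -mean_affine; apply: log_mean_le (measurable_affine a b)
  (@affine_lb a b).
Qed.

Lemma log_mean_ge_affine f g x a b :
  {in I01, forall t, ((1 - t) * a + t * b)%:E <= harm_mean t f g x}%E ->
  (((a + b) / 2)%:E <= log_mean f g x)%E.
Proof.
by rewrite -mean_affine; apply: log_mean_ge (measurable_affine a b)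
  (@affine_lb a b).
Qed.

Lemma log_mean_ge_dual f g x p a b :
  conjugate f p = a%:E -> conjugate g p = b%:E ->
  ((re (p x) - (a + b) / 2)%:E <= log_mean f g x)%E.
Proof.
move=> fa gb; rewrite (_ : _ - _ = ((re (p x) - a) + (re (p x) - b)) / 2);
  last by field.
apply: log_mean_ge_affine => t /I01P t01.
rewrite (_ : (1 - t) * _ + _ = re (p x) - ((1 - t) * a + t * b)); last by ring.
by apply: harm_mean_ge => //; rewrite ?fa ?gb.
Qed.

Lemma half01 : 0 < (2^-1 : R) < 1.
Proof. by apply/andP; split; lra. Qed.

(** The first moment being 1/2, an affine function of [t] has its value at 1/2 as mean. Thus each
    finite term of the supremum defining [harm_mean 2^-1 f g x] is the bound of [log_mean_ge_dual]
    at the same dual point. *)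
Lemma harm_le_log_mean f g x :
  (forall p, conjugate f p != -oo%E) -> (forall p, conjugate g p != -oo%E) ->
  (harm_mean 2^-1 f g x <= log_mean f g x)%E.
Proof.
move=> fNy gNy; apply: harm_mean_le half01 fNy gNy _ => p a b fa gb.
apply: le_trans (log_mean_ge_dual x fa gb).
by rewrite lee_fin; lra.
Qed.

Lemma log_le_arith_mean f g x :
  (forall p, conjugate f p != -oo%E) -> (forall p, conjugate g p != -oo%E) ->
  f x != -oo%E -> g x != -oo%E ->
  (log_mean f g x <= arith_mean 2^-1 f g x)%E.
Proof.
move=> fNy gNy; case fx : (f x) => [a| |]// _; last first.
  by rewrite arith_meany ?leey//; [exact: half01|left].
case gx : (g x) => [b| |]// _; last first.
  by rewrite arith_meany ?leey//; [exact: half01|right].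
rewrite (arith_mean_fin half01 fx gx).
rewrite (_ : _ + _ = (a + b) / 2); last by field.
apply: log_mean_le_affine => t /I01P t01; apply: harm_mean_le => //
  p a' b' fp gp.
(* The Fenchel-Young inequalities for [f] and [g], weighted by [1 - t] and [t], put every dual term
   below the chord from [a] to [b]. *)
have := @fenchel_young _ _ _ f p x a'; rewrite fp fx lexx => /(_ isT).
have := @fenchel_young _ _ _ g p x b'; rewrite gp gx lexx => /(_ isT).
by rewrite !lee_fin; have /andP[t0 t1] := t01; nra.
Qed.

(** No dual point contributes, so the harmonic means lie below every real [r]. Real constants are
    used as bounds because [log_mean_le] compares with functions bounded below. *)
Lemma log_mean_Ny f g x :
  (forall p, conjugate f p != -oo%E) -> (forall p, conjugate g p != -oo%E) ->
  ~ (edom (conjugate f) `&` edom (conjugate g) !=set0) ->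
  log_mean f g x = -oo%E.
Proof.
move=> fNy gNy nfg.
have H r : (log_mean f g x <= r%:E)%E.
  rewrite (_ : r = (r + r) / 2); last by field.
  apply: log_mean_le_affine => t /I01P t01; apply: harm_mean_le => //
    p a b fa gb.
  by exfalso; apply: nfg; exists p; rewrite /edom/= fa gb !ltry.
case: (log_mean f g x) H => [r| |]// H; last by have := H 0.
by exfalso; have := H (r - 1); rewrite lee_fin; lra.
Qed.

Lemma log_mean_gtNy f g x : conj_proper f g -> log_mean f g x != -oo%E.
Proof.
move=> [fNy gNy [p [fp gp]]]; have := @log_mean_ge_dual f g x p.
have := fNy p; have := gNy p; rewrite /edom/= in fp gp.
case: (conjugate f p) fp => [a| |]// _; case: (conjugate g p) gp => [b| |]//
  _ _ _.
by move=> /(_ _ _ erefl erefl); rewrite -ltNye; apply: lt_le_trans;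
  exact: ltNyr.
Qed.

End log_mean_theory.

(** * Convexity, lower semicontinuity and joint concavity *)

Section log_mean_regularity.
Context {R : realType} {k : scalar_kind} {E : tvsType (scalar_field R k)}.
Implicit Types (f g : E -> \bar R) (p q : dual E) (x y : E) (s t a b : R).
Local Notation re := (re_part k).
Local Notation I01 := (`]0%R, 1%R[%classic : set R).

Lemma mean_subr (u : R -> R) (M e : R) : 0 <= M -> 0 <= e ->
  measurable_fun I01 u -> {in I01, forall t, - M <= u t} ->
  (mean (fun t => (u t - e)%:E) = mean (EFin \o u) - e%:E)%E.
Proof.
move=> M0 e0 mu uM.
rewrite (@mean_shift _ (EFin \o u) M)//; last first.
  by apply/measurable_EFinP.
rewrite (@mean_shift _ _ (M + e)) ?addr_ge0//; last 2 first.
- by apply/measurable_EFinP; exact: measurable_funB.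
- by move=> t t01; rewrite lee_fin opprD lerB// uM.
rewrite EFinD fin_num_oppeD// addeA; congr (_ - _ - _)%E.
by apply: eq_mean => t _; rewrite -!EFinD; congr (_%:E); ring.
Qed.

Lemma comb_lb (u v : \bar R) M s : 0 < s < 1 ->
  ((- M)%:E <= u)%E -> ((- M)%:E <= v)%E ->
  ((- M)%:E <= (1 - s)%:E * u + s%:E * v)%E.
Proof.
move=> /andP[s0 s1] uM vM.
rewrite (_ : - M = (1 - s) * (- M) + s * (- M)); last by ring.
by rewrite EFinD !EFinM; apply: leeD; apply: lee_wpmul2l;
  rewrite ?lee_fin ?subr_ge0 ?(ltW s0) ?(ltW s1).
Qed.

Lemma common_lb f1 g1 x f2 g2 y : conj_proper f1 g1 -> conj_proper f2 g2 ->
  exists M, [/\ 0 <= M, {in I01, forall t, (- M)%:E <= harm_mean t f1 g1 x}%E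
    & {in I01, forall t, (- M)%:E <= harm_mean t f2 g2 y}%E].
Proof.
move=> /(harm_mean_lb x)[M [M0 h1]] /(harm_mean_lb y)[N [N0 h2]].
exists (M + N); split; first exact: addr_ge0.
- by move=> t /h1; apply: le_trans; rewrite lee_fin lerN2 lerDl.
- by move=> t /h2; apply: le_trans; rewrite lee_fin lerN2 lerDr.
Qed.

(** Puts a combination under one integral, both for convexity (two points, one pair of functionals)
    and for concavity (one point, two pairs). Neither mean is [-oo], so the two additions agree. *)
Lemma arith_log_meanE s f1 g1 f2 g2 x y : 0 < s < 1 ->
  conj_proper f1 g1 -> conj_proper f2 g2 ->
  ((1 - s)%:E * log_mean f1 g1 x + s%:E * log_mean f2 g2 y)%dE =
  mean (fun t =>
    (1 - s)%:E * harm_mean t f1 g1 x + s%:E * harm_mean t f2 g2 y)%E.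
Proof.
move=> s01 h1 h2; have [M [M0 M1 M2]] := common_lb x y h1 h2.
rewrite (mean_comb s01 M0)//;
  [|exact: measurable_harm_mean|exact: measurable_harm_mean].
rewrite -!log_meanE//.
have := @arith_mean_def _ _ s (fun=> log_mean f1 g1 x) (fun=> log_mean f2 g2 y)
  tt s01.
by rewrite arith_meanE//; apply; exact: log_mean_gtNy.
Qed.

Lemma log_mean_convex f g : conj_proper f g -> convex_functional (log_mean f g).
Proof.
move=> fg x y s s01; rewrite arith_log_meanE//.
have [M [M0 M1 M2]] := common_lb x y fg fg.
apply: (@log_mean_le _ _ _ _ _ _ _ M).
- by apply: emeasurable_funD; apply: measurable_funeM;
    exact: measurable_harm_mean.
- by move=> t t01; apply: comb_lb => //; [exact: M1|exact: M2].
move=> t /I01P t01; have [fNy gNy _] := fg; apply: harm_mean_le => //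
  p a b fa gb.
(* Each dual term is real-affine in the point, and its values at [x] and [y] stay below the harmonic
   means there. *)
rewrite re_dual_comb (_ : _ - _ = (1 - s) * (re (p x) - ((1 - t) * a + t * b)) +
  s * (re (p y) - ((1 - t) * a + t * b))); last by ring.
have /andP[s0 s1] := s01; rewrite EFinD !EFinM.
by apply: leeD; apply: lee_wpmul2l;
  rewrite ?lee_fin ?subr_ge0 ?(ltW s0) ?(ltW s1)//;
  apply: harm_mean_ge; rewrite ?fa ?gb.
Qed.

(** Finitely many continuous functionals are involved, and the increment [re (p i y) - re (p i x)]
    does not depend on [t]; so one neighbourhood serves all [t]. *)
Lemma sup_seq_near f g (p : nat -> dual E) x n e : 0 < e ->
  \forall y \near x, forall t, sup_seq f g p x t n - e <= sup_seq f g p y t n.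
Proof.
move=> e0.
have : \forall y \near x, forall i : 'I_n.+1, re (p i x) - e < re (p i y).
  by apply: filter_forall => i; exact: re_dual_near.
apply: filterS => y H t.
have [i ni ex] := runmaxP (fun i => affine_val f g (p i) x t) n.
rewrite /sup_seq ex.
have := H (Ordinal (ni : (i < n.+1)%N)) => /= Hi.
apply: (@le_trans _ _ (affine_val f g (p i) y t));
  first by rewrite /affine_val; lra.
apply: le_trans (le_runmax (fun i => affine_val f g (p i) y t) i) _.
exact: runmax_nd.
Qed.

(* A countable family of dual points already attains [harm_mean t f g x] for all
   [t]; this lets monotone convergence replace the fact that integration need
   not commute with uncountable suprema. *)
Lemma log_mean_lsc f g : conj_proper f g -> lower_semicontinuous (log_mean f g).
Proof.
move=> fg x a; rewrite log_meanE// => ax.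
have [p [pfin pc]] := harm_mean_cvg x fg.
have [M [M0 pM]] := sup_seq_lb f g p x.
have cm : (mean (EFin \o (fun t => sup_seq f g p x t n)) @[n --> \oo] -->
    mean (fun t => harm_mean t f g x))%E.
  apply: (mean_cvg (f := fun n t => sup_seq f g p x t n) M0) => //.
  - by move=> n; exact: measurable_sup_seq.
  - by move=> t _ m n mn;
      exact: (@runmax_nd _ (fun i => affine_val f g (p i) x t)).
  - by move=> t /I01P; exact: pc.
have [n an] : exists n,
  (a%:E < mean (EFin \o (fun t => sup_seq f g p x t n)))%E.
  apply: contrapT => /forallNP H.
  suff : (mean (fun t => harm_mean t f g x) <= a%:E)%E by rewrite leNgt ax.
  rewrite -(cvg_lim _ cm)//; apply: lime_le; first by apply/cvg_ex; eexists;
    exact: cm.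
  by apply: nearW => n; rewrite leNgt; apply/negP; exact: H.
(* Half the gap to [a], or 1 if the mean is infinite. As the mass is one, lowering the integrand by
   [e] lowers the mean by [e]. *)
have [e e0 ae] : exists2 e : R, 0 < e &
    (a%:E < mean (EFin \o (fun t => sup_seq f g p x t n)) - e%:E)%E.
  move: an; case: (mean _) => [r| |]// ar; last first.
    by exists 1 => //; exact: ltry.
  rewrite lte_fin in ar.
  exists ((r - a) / 2); first by rewrite divr_gt0// subr_gt0.
  by rewrite -EFinB lte_fin; lra.
exists [set y | forall t, sup_seq f g p x t n - e <= sup_seq f g p y t n].
  exact: sup_seq_near.
move=> y /= Hy; apply: (lt_le_trans ae).
rewrite -(mean_subr M0 (ltW e0) (measurable_sup_seq _ _ _ _ _) (pM n)).
apply: (@log_mean_ge _ _ _ _ _ _ _ (M + e)).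
- by apply/measurable_EFinP; apply: measurable_funB => //;
    exact: measurable_sup_seq.
- by move=> t t01; rewrite lee_fin opprD lerB// pM.
move=> t /I01P t01; apply: (@le_trans _ _ (sup_seq f g p y t n)%:E);
  first by rewrite lee_fin.
have [i _ ei] := runmaxP (fun i => affine_val f g (p i) y t) n.
rewrite /sup_seq ei; have [? ?] := pfin i.
by apply: harm_mean_ge => //; rewrite fineK.
Qed.

(* The first hypothesis says that [f] dominates the convex combination of [f1] and
   [f2], through real minorants because the values may be infinite; it covers both
   [f = arith_mean s f1 f2] and [f = f1 = f2]. *)
Lemma le_conjugate_comb f1 f2 f p1 p2 q a1 a2 s :
  (forall x r1 r2, (r1%:E <= f1 x)%E -> (r2%:E <= f2 x)%E ->
    (((1 - s) * r1 + s * r2)%:E <= f x)%E) ->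
  (forall x, re (q x) = (1 - s) * re (p1 x) + s * re (p2 x)) ->
  (conjugate f1 p1 <= a1%:E)%E -> (conjugate f2 p2 <= a2%:E)%E ->
  (conjugate f q <= ((1 - s) * a1 + s * a2)%:E)%E.
Proof.
move=> ff qE c1 c2; apply: ge_ereal_sup => _ [x _ <-].
have := ff x _ _ (fenchel_young x c1) (fenchel_young x c2).
rewrite qE; case: (f x) => [r| |]//; last by rewrite leNye.
by rewrite -EFinB !lee_fin; lra.
Qed.

(** Both suprema are approached by values at single dual points [p1 i] and [p2 j], whose combination
    competes in the supremum for [f] and [g]. The lower bounds exclude [-oo], so the sum of the two
    limits is well defined. *)
Lemma harm_mean_concave f1 f2 f g1 g2 g x s t : 0 < s < 1 -> 0 < t < 1 ->
  conj_proper f1 g1 -> conj_proper f2 g2 ->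
  (forall x r1 r2, (r1%:E <= f1 x)%E -> (r2%:E <= f2 x)%E ->
    (((1 - s) * r1 + s * r2)%:E <= f x)%E) ->
  (forall x r1 r2, (r1%:E <= g1 x)%E -> (r2%:E <= g2 x)%E ->
    (((1 - s) * r1 + s * r2)%:E <= g x)%E) ->
  ((1 - s)%:E * harm_mean t f1 g1 x + s%:E * harm_mean t f2 g2 x <=
    harm_mean t f g x)%E.
Proof.
move=> s01 t01 fg1 fg2 ff gg; have /andP[s0 s1] := s01.
have [p1 [fin1 c1]] := harm_mean_cvg x fg1.
have [p2 [fin2 c2]] := harm_mean_cvg x fg2.
have [M1 [_ m1]] := harm_mean_lb x fg1; have [M2 [_ m2]] := harm_mean_lb x fg2.
have t01' : t \in I01 by apply/mem_set; rewrite /= in_itv.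
have c : (((1 - s)%:E * (sup_seq f1 g1 p1 x t n)%:E +
  s%:E * (sup_seq f2 g2 p2 x t n)%:E)
    @[n --> \oo] -->
    (1 - s)%:E * harm_mean t f1 g1 x + s%:E * harm_mean t f2 g2 x)%E.
  apply: cvgeD; [|apply: cvgeZl => //; exact: c1|apply: cvgeZl => //;
    exact: c2].
  have s'0 : 0 < 1 - s by rewrite subr_gt0.
  move: (m1 t t01') (m2 t t01').
  by case: (harm_mean t f1 g1 x) => [u| |]//;
    case: (harm_mean t f2 g2 x) => [v| |]// _ _;
    rewrite ?gt0_muley ?lte_fin.
rewrite -(cvg_lim _ c)//; apply: lime_le; first by apply/cvg_ex; eexists;
  exact: c.
apply: nearW => n.
have [i _ ei] := runmaxP (fun i => affine_val f1 g1 (p1 i) x t) n.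
have [j _ ej] := runmaxP (fun i => affine_val f2 g2 (p2 i) x t) n.
rewrite /sup_seq ei ej -!EFinM -EFinD /affine_val.
have [f1i g1i] := fin1 i; have [f2j g2j] := fin2 j.
have [q qE] := dual_comb (p1 i) (p2 j) s.
have fq : (conjugate f q <= ((1 - s) * fine (conjugate f1 (p1 i)) +
  s * fine (conjugate f2 (p2 j)))%:E)%E.
  by apply: le_conjugate_comb ff qE _ _; rewrite fineK.
have gq : (conjugate g q <= ((1 - s) * fine (conjugate g1 (p1 i)) +
  s * fine (conjugate g2 (p2 j)))%:E)%E.
  by apply: le_conjugate_comb gg qE _ _; rewrite fineK.
apply: le_trans (harm_mean_ge x t01 fq gq).
by rewrite qE lee_fin le_eqVlt; apply/orP; left; apply/eqP; ring.
Qed.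

Lemma log_mean_concave f1 f2 f g1 g2 g x s : 0 < s < 1 ->
  conj_proper f1 g1 -> conj_proper f2 g2 ->
  (forall x r1 r2, (r1%:E <= f1 x)%E -> (r2%:E <= f2 x)%E ->
    (((1 - s) * r1 + s * r2)%:E <= f x)%E) ->
  (forall x r1 r2, (r1%:E <= g1 x)%E -> (r2%:E <= g2 x)%E ->
    (((1 - s) * r1 + s * r2)%:E <= g x)%E) ->
  (arith_mean s (log_mean f1 g1) (log_mean f2 g2) x <= log_mean f g x)%E.
Proof.
move=> s01 fg1 fg2 ff gg; rewrite arith_meanE// arith_log_meanE//.
have [M [M0 M1 M2]] := common_lb x x fg1 fg2.
apply: (@log_mean_ge _ _ _ _ _ _ _ M).
- by apply: emeasurable_funD; apply: measurable_funeM;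
    exact: measurable_harm_mean.
- by move=> t t01; apply: comb_lb => //; [exact: M1|exact: M2].
by move=> t /I01P t01; exact: harm_mean_concave.
Qed.

Lemma arith_mean_lb f1 f2 s x r1 r2 : 0 < s < 1 ->
  (r1%:E <= f1 x)%E -> (r2%:E <= f2 x)%E ->
  (((1 - s) * r1 + s * r2)%:E <= arith_mean s f1 f2 x)%E.
Proof.
move=> s01 h1 h2; rewrite -(@arith_mean_fin _ _ s (fun=> r1%:E) (fun=> r2%:E)
  x)//.
exact: le_arith_mean.
Qed.

(** Derives separate concavity from the joint one: the fixed argument is repeated. *)
Lemma self_comb_lb f s x r1 r2 : 0 < s < 1 ->
  (r1%:E <= f x)%E -> (r2%:E <= f x)%E -> (((1 - s) * r1 + s * r2)%:E <= f x)%E.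
Proof.
move=> /andP[s0 s1]; case: (f x) => [r| |]//; last by rewrite !leey.
by rewrite !lee_fin; nra.
Qed.

Lemma Gamma0_conjugate_gtNy f p : Gamma0 f -> conjugate f p != -oo%E.
Proof. by move=> [_ _ [_ ?]]; exact: conjugate_gtNy. Qed.

Lemma finite_conjugates_proper f g : finite_conjugates (f, g) ->
  conj_proper f g.
Proof.
move=> [/= Gf Gg df dg]; split; [by move=> p; exact: Gamma0_conjugate_gtNy..|].
by have [p _] := @dual0 R k E; exists p; rewrite df dg.
Qed.
End log_mean_regularity.

Theorem theorem6p3 (R : realType) (k : scalar_kind)
    (E : tvsType (scalar_field R k)) :
  (* (i) *)
  [/\ forall g : E -> \bar R,
        pointwise_increasing [set f | finite_conjugates (f, g)]
          (fun f => log_mean f g),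
      forall f : E -> \bar R,
        pointwise_increasing [set g | finite_conjugates (f, g)]
          (fun g => log_mean f g),
      forall g : E -> \bar R,
        pointwise_concave [set f | finite_conjugates (f, g)]
          (fun f => log_mean f g)
    & forall f : E -> \bar R,
        pointwise_concave [set g | finite_conjugates (f, g)]
          (fun g => log_mean f g)] /\
  (* (ii) *)
  (forall f g : E -> \bar R, Gamma0 f -> Gamma0 g ->
    [/\ pointwise_le (harm_mean 2^-1 f g) (log_mean f g),
        pointwise_le (log_mean f g) (arith_mean 2^-1 f g)
      & edom f `&` edom g !=set0 ->
        [/\ convex_functional (log_mean f g),
            lower_semicontinuous (log_mean f g),
            exists x, log_mean f g x != +oo%E
          (* properness fails, with log_mean f g = -oo, when the domains of the
             conjugates are disjoint, as for f = id and g = - id on R *)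
          & edom (conjugate f) `&` edom (conjugate g) !=set0 ->
            Gamma0 (log_mean f g)]]).
Proof.
split.
  split=> [g f1 f2 _ _ f12 x|f g1 g2 _ _ g12 x|g f1 f2 s|f g1 g2 s].
  - exact: le_log_mean.
  - exact: le_log_mean.
  - move=> /finite_conjugates_proper fg1 /finite_conjugates_proper fg2 s01 x.
    apply: log_mean_concave => // y r1 r2; first exact: arith_mean_lb.
    exact: self_comb_lb.
  - move=> /finite_conjugates_proper fg1 /finite_conjugates_proper fg2 s01 x.
    apply: log_mean_concave => // y r1 r2; first exact: self_comb_lb.
    exact: arith_mean_lb.
move=> f g Gf Gg.
have fNy p := Gamma0_conjugate_gtNy p Gf;
  have gNy p := Gamma0_conjugate_gtNy p Gg.
have [_ _ [fx _]] := Gf; have [_ _ [gx _]] := Gg.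
have upper : pointwise_le (log_mean f g) (arith_mean 2^-1 f g).
  by move=> x; exact: log_le_arith_mean.
split=> // [x|[x [fxy gxy]]]; first exact: harm_le_log_mean.
rewrite /edom/= in fxy gxy.
have Lx : log_mean f g x != +oo%E.
  rewrite -ltey; apply: le_lt_trans (upper x) _.
  case fE : (f x) (fx x) fxy => [a| |]// _ _;
    case gE : (g x) (gx x) gxy => [b| |]// _ _.
  by rewrite (arith_mean_fin half01 fE gE) ltry.
have [fg|nfg] := pselect (edom (conjugate f) `&` edom (conjugate g) !=set0).
  have pfg : conj_proper f g by [].
  have cvx := log_mean_convex pfg; have lsc := log_mean_lsc pfg.
  split=> //; first by exists x.
  by move=> _; split=> //; split; [move=> y; exact: log_mean_gtNy|exists x].
(* The constant [-oo] is convex and lower semicontinuous, which settles the improper case. *)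
have LE y : log_mean f g y = -oo%E by exact: log_mean_Ny.
split=> //; last by exists x.
- by move=> y z s s01; rewrite LE leNye.
- by move=> y a; rewrite LE ltNge leNye.
Qed.
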